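(* Let $M\ge K\ge 1$ be integers, let $\mathbf{R}_1,\dots,\mathbf{R}_K\in\mathbb{C}^{M\times M}$ be Hermitian positive semidefinite matrices, and let $\mathbf{h}_{1},\dots,\mathbf{h}_{K}$ be independent random vectors with $\mathbf{h}_{k}\sim\mathcal{CN}(\mathbf{0},\mathbf{R}_k)$. Put $\mathbf{H}_{\mathrm d}=[\mathbf{h}_{1}\cdots\mathbf{h}_{K}]\in\mathbb{C}^{M\times K}$. For $p_{\mathrm c}>0$ let $$\mathcal{R}_{\mathrm d}(p_{\mathrm c})=\max_{p_1,\dots,p_K\ge 0,\ \sum_{k=1}^{K}p_k\le p_{\mathrm c}}\log_2\det\Big(\mathbf{I}_M+\sum_{k=1}^{K}p_k\mathbf{h}_{k}\mathbf{h}_{k}^{\mathsf H}\Big),$$ and let $\mathcal{R}_{\mathrm d,c}(p_{\mathrm c})=\mathbb{E}\{\mathcal{R}_{\mathrm d}(p_{\mathrm c})\}$ be the downlink ergodic communication rate. Then, as $p_{\mathrm c}\to\infty$, $\mathcal{R}_{\mathrm d,c}(p_{\mathrm c})$ is asymptotically $K\log_2\frac{p_{\mathrm c}}{K}+\mathbb{E}\{\log_2\det(\mathbf{H}_{\mathrm d}^{\mathsf H}\mathbf{H}_{\mathrm d})\}$, that is, $$\lim_{p_{\mathrm c}\to\infty}\Big(\mathcal{R}_{\mathrm d,c}(p_{\mathrm c})-K\log_2\frac{p_{\mathrm c}}{K}\Big)=\mathbb{E}\big\{\log_2\det\big(\mathbf{H}_{\mathrm d}^{\mathsf H}\mathbf{H}_{\mathrm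 d}\big)\big\}.$$
   Context: $\mathcal{CN}(\mathbf{0},\mathbf{R})$ denotes the circularly symmetric complex Gaussian distribution with mean zero and covariance $\mathbf{R}$; $(\cdot)^{\mathsf H}$ is the conjugate transpose. The base station has $M$ transmit antennas and serves $K$ single-antenna communication users; $\mathbf{h}_k$ is the downlink channel vector of user $k$, $\mathbf{R}_k$ its transmit correlation matrix, and $p_{\mathrm c}$ is the communication SNR. The convention $\log_2 0=-\infty$ is used, so in degenerate cases the limit is understood in $[-\infty,\infty)$. *)

(* Defs.v *)
From HB Require Import structures.
From mathcomp Require Import all_boot all_order all_algebra.
From mathcomp Require Import all_classical all_reals all_analysis.
From mathcomp Require Import complex.

Set Implicit Arguments.
Unset Strict Implicit.
Unset Printing Implicit Defensive.

Import Order.TTheory GRing.Theory Num.Theory.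
Import numFieldNormedType.Exports.

Local Open Scope classical_set_scope.
Local Open Scope ring_scope.
Local Open Scope sesquilinear_scope.
Local Open Scope complex_scope.

(* Re and Im are otherwise the R[i]-valued 'Re and 'Im. *)
Local Notation Re := complex.Re.
Local Notation Im := complex.Im.

Section Logarithms.
Variable R : realType.

Definition log2 (x : R) : R := ln x / ln 2.

(* [lne] sends 0 to -oo, which gives the convention log2 0 = -oo. *)
Definition log2e (x : R) : \bar R := (lne x%:E * ((ln 2)^-1)%:E)%E.

End Logarithms.

Section ComplexVectors.
Variable R : realType.

(* For z : R[i], [0 <= z] means that z is real and nonnegative. *)
Definition hermitian_psd (n : nat) (A : 'M[R[i]]_n) : Prop :=
  A \is hermsymmx /\ forall u : 'cV[R[i]]_n, 0 <= (u^t* *m A *m u) 0 0.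

(* C^n as (R^2)^n, where the measurable structure is the Borel one. *)
Definition cV_coords (n : nat) (v : 'cV[R[i]]_n) : n.-tuple (R * R)%type :=
  [tuple (Re (v i 0), Im (v i 0)) | i < n].

End ComplexVectors.

Section RandomVectors.
Variables (R : realType) (d : measure_display) (T : measurableType d).
Variable P : probability T R.

(* A real integral that equals a finite number is never the result of a
   convention for undefined integrals (+oo - +oo is -oo in \bar R), so this
   includes the integrability of Z. *)
Definition complex_expectation_is (Z : T -> R[i]) (z : R[i]) : Prop :=
  'E_P[fun w => Re (Z w)]%E = (Re z)%:E /\
  'E_P[fun w => Im (Z w)]%E = (Im z)%:E.

(* The law N(m, s^2), with N(m, 0) the Dirac mass at m. The case s = 0 is
   separate because [normal_prob m 0] is the uniform law on [0, 1]. *)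
Definition gaussian_law (m s : R) (A : set R) : \bar R :=
  if s == 0 then \d_m A else normal_prob m s A.

Section Gaussian.
Variable n : nat.
Implicit Type X : T -> 'cV[R[i]]_n.

Definition random_vector X : Prop :=
  measurable_fun [set: T] (fun w => cV_coords (X w)).

(* The maps x |-> Re (u^H x) are all the real linear forms on C^n = R^(2n), so
   this is joint Gaussianity of the real and imaginary parts of the entries. *)
Definition gaussian_vector X : Prop :=
  forall u : 'cV[R[i]]_n, exists m s : R,
    0 <= s /\
    forall A : set R, measurable A ->
      P ((fun w => Re ((u^t* *m X w) 0 0)) @^-1` A) = gaussian_law m s A.

Definition circularly_symmetric X : Prop :=
  forall c : R[i], `|c| = 1 ->
  forall B : set (n.-tuple (R * R)%type), measurable B ->
    P ((fun w => cV_coords (c *: X w)) @^-1` B) =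
    P ((fun w => cV_coords (X w)) @^-1` B).

Definition mean_zero X : Prop :=
  forall i, complex_expectation_is (fun w => X w i 0) 0.

Definition covariance_is X (A : 'M[R[i]]_n) : Prop :=
  forall i j, complex_expectation_is (fun w => (X w *m (X w)^t*) i j) (A i j).

(* X ~ CN(0, A) *)
Definition CN0 (A : 'M[R[i]]_n) X : Prop :=
  [/\ random_vector X, gaussian_vector X, circularly_symmetric X,
      mean_zero X & covariance_is X A].

Definition mutually_independent (K : nat) (X : 'I_K -> T -> 'cV[R[i]]_n) :
    Prop :=
  forall (J : {set 'I_K}) (B : 'I_K -> set (n.-tuple (R * R)%type)),
    (forall k, measurable (B k)) ->
    P [set w | forall k, k \in J -> B k (cV_coords (X k w))] =
    (\prod_(k in J) P ((fun w => cV_coords (X k w)) @^-1` B k))%E.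

End Gaussian.
End RandomVectors.

Section DownlinkRate.
Variables (R : realType) (M K : nat).
Implicit Types (h : 'I_K -> 'cV[R[i]]_M) (p : 'I_K -> R) (pc : R).

Definition channel_matrix h : 'M[R[i]]_(M, K) := \matrix_(i, k) h k i 0.

(* The determinants below are those of Hermitian matrices, hence real. *)
Definition sum_rate h p : R :=
  log2 (Re (\det (1%:M + \sum_k (p k)%:C *: (h k *m (h k)^t*)))).

Definition power_allocations pc : set ('I_K -> R) :=
  [set p | (forall k, 0 <= p k) /\ \sum_k p k <= pc].

(* For pc >= 0 the sup is a max: [sum_rate h] is continuous on the compact
   nonempty set [power_allocations pc], where the determinant is >= 1. *)
Definition downlink_rate h pc : R :=
  sup [set sum_rate h p | p in power_allocations pc].

Definition log2_det_gram h : \bar R :=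
  log2e (Re (\det ((channel_matrix h)^t* *m channel_matrix h))).

End DownlinkRate.

Definition ergodic_downlink_rate (R : realType) (d : measure_display)
    (T : measurableType d) (P : probability T R) (M K : nat)
    (h : 'I_K -> T -> 'cV[R[i]]_M) (pc : R) : \bar R :=
  ('E_P[fun w => downlink_rate (fun k => h k w) pc])%E.

(* Main.v *)
(** With [H] the channel matrix, [G = H^H H] its Gram matrix and [D = diag p], Sylvester's
    identity gives [det (I + H D H^H) = det (I + G D)].

    Equal powers [p_k = pc / K] bound the rate below by
    [log2 (det (K / pc I + G)) + K log2 (pc / K)], hence by
    [log2 (det G) + K log2 (pc / K)]. For the converse, raise every power by [c > 0]:
    then [det (I + G (D + c I)) = det ((D + c I)^-1 + G) prod_k (p_k + c)], where the
    first factor is at most [det (c^-1 I + G)] and the second at most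
    [((pc + K c) / K)^K] by the AM-GM inequality. The monotonicity of these
    determinants comes from rank-one updates of positive matrices.

    Letting [c] grow like [sqrt pc] makes [K log2 (1 + K c / pc)] vanish, while the
    expectation of [log2 (det (c^-1 I + G))] decreases to that of [log2 (det G)]. *)

Require Import Defs.
From HB Require Import structures.
From mathcomp Require Import all_boot all_order all_algebra.
From mathcomp Require Import all_classical all_reals all_analysis.
From mathcomp Require Import perm measurable_realfun.
From mathcomp Require Import complex.
Import Order.TTheory GRing.Theory Num.Theory.
Import numFieldNormedType.Exports.
Local Open Scope classical_set_scope.
Local Open Scope ring_scope.
Local Open Scope sesquilinear_scope.
Local Open Scope complex_scope.

Set Implicit Arguments.
Unset Strict Implicit.
Unset Printing Implicit Defensive.

Local Notation Re := complex.Re.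
Local Notation Im := complex.Im.

(** * Determinants of positive matrices *)

(** Sylvester's identity: [X *m L] and [L *m X] are both block upper triangular with one identity
    diagonal block, and their determinants agree. *)
Lemma det_addmulC (R : comNzRingType) m n (A : 'M[R]_(m, n)) (B : 'M[R]_(n, m)) :
  \det (1%:M + A *m B) = \det (1%:M + B *m A).
Proof.
pose L : 'M[R]_(m + n) := block_mx 1%:M 0 B 1%:M.
pose X : 'M[R]_(m + n) := block_mx 1%:M A (- B) 1%:M.
have <- : \det (X *m L) = \det (1%:M + A *m B).
  rewrite /X /L mulmx_block !mul1mx !mulmx1 !mulmx0 !add0r addNr.
  by rewrite det_ublock det1 mulr1.
have <- : \det (L *m X) = \det (1%:M + B *m A).
  rewrite /X /L mulmx_block !mul1mx !mulmx1 !mul0mx !addr0 subrr.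
  by rewrite det_ublock det1 mul1r addrC.
by rewrite !det_mulmx mulrC.
Qed.

Section PositiveDefinite.
Variable C : numClosedFieldType.
Implicit Types m n : nat.

(** Since [0 <= z] forces [z] to be real, the second condition already makes [A] Hermitian; the
    nonzero determinant then gives positive definiteness. *)
Definition posdef n (A : 'M[C]_n) : Prop :=
  0 < \det A /\ forall u : 'cV[C]_n, 0 <= (u^t* *m A *m u) 0 0.

Lemma trmxC_mul m n p (A : 'M[C]_(m, n)) (B : 'M[C]_(n, p)) :
  (A *m B)^t* = B^t* *m A^t*.
Proof. by rewrite trmx_mul map_mxM. Qed.

(** Substituting [v = A *m w] turns the form of the inverse at [v] into the conjugate of the form of
    [A] at [w]. *)
Lemma posdef_invmx_ge0 n (A : 'M[C]_n) (v : 'cV[C]_n) :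
  posdef A -> 0 <= (v^t* *m invmx A *m v) 0 0.
Proof.
move=> [dA qA]; have uA : A \in unitmx by rewrite unitmxE unitfE gt_eqF.
have [w ->] : exists w, v = A *m w by exists (invmx A *m v); rewrite mulKVmx.
have -> : (A *m w)^t* *m invmx A *m (A *m w) = (w^t* *m A *m w)^t*.
  by rewrite !trmxC_mul trmxCK -!mulmxA mulKmx.
by rewrite !mxE conjC_ge0; have := qA w; rewrite mxE.
Qed.

(** The matrix determinant lemma: after factoring out [A], Sylvester's identity leaves a 1 by 1
    determinant. *)
Lemma det_rank1_update n (A : 'M[C]_n) (x : C) (v : 'cV[C]_n) :
  \det A != 0 ->
  \det (A + x *: (v *m v^t*)) = \det A * (1 + x * (v^t* *m invmx A *m v) 0 0).
Proof.
move=> dA; have uA : A \in unitmx by rewrite unitmxE unitfE.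
have -> : A + x *: (v *m v^t*) = A *m (1%:M + (x *: (invmx A *m v)) *m v^t*).
  by rewrite mulmxDr mulmx1 -scalemxAl -scalemxAr !mulmxA mulmxV// mul1mx.
rewrite det_mulmx det_addmulC det_mx11 -scalemxAr mulmxA.
by rewrite [X in _ * X]mxE !mxE.
Qed.

(** The determinant is multiplied by a factor at least 1. Positivity is part of the conclusion so
    that updates can be iterated. *)
Lemma posdef_rank1_update n (A : 'M[C]_n) (x : C) (v : 'cV[C]_n) :
  posdef A -> 0 <= x ->
  posdef (A + x *: (v *m v^t*)) /\ \det A <= \det (A + x *: (v *m v^t*)).
Proof.
move=> pA x0; have [dA qA] := pA.
have leA : \det A <= \det (A + x *: (v *m v^t*)).
  rewrite det_rank1_update ?gt_eqF// mulrDr mulr1 lerDl.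
  by apply: mulr_ge0; [exact: ltW | rewrite mulr_ge0 ?posdef_invmx_ge0].
split=> //; split=> [|u]; first exact: lt_le_trans leA.
rewrite mulmxDr mulmxDl -scalemxAr -scalemxAl mxE addr_ge0 ?qA// mxE.
rewrite mulr_ge0// mulmxA -(mulmxA _ (v^t*)) mxE big_ord1.
have -> : v^t* *m u = (u^t* *m v)^t* by rewrite trmxC_mul trmxCK.
by rewrite [X in _ * X]mxE [X in _ * Num.conj X]mxE mul_conjC_ge0.
Qed.

Lemma posdef_sum_update n (A : 'M[C]_n) (I : Type) (r : seq I) (x : I -> C)
    (v : I -> 'cV[C]_n) :
  posdef A -> (forall i, 0 <= x i) ->
  posdef (A + \sum_(i <- r) x i *: (v i *m (v i)^t*)) /\
  \det A <= \det (A + \sum_(i <- r) x i *: (v i *m (v i)^t*)).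
Proof.
move=> pA x0; elim: r => [|i r [pB leB]]; first by rewrite big_nil addr0.
rewrite big_cons addrCA addrC.
by have [pD leD] := posdef_rank1_update (v i) pB (x0 i); split=> //; apply: le_trans leD.
Qed.

Lemma posdef_diag n (d : 'rV[C]_n) : (forall i, 0 < d 0 i) -> posdef (diag_mx d).
Proof.
move=> d0; split=> [|u]; first by rewrite det_diag prodr_gt0.
rewrite mul_mx_diag mxE sumr_ge0// => i _; rewrite !mxE mulrAC.
by apply: mulr_ge0; [rewrite mulrC mul_conjC_ge0 | exact: ltW].
Qed.

Lemma posdef1 n : posdef (1%:M : 'M[C]_n).
Proof. by rewrite -diag_const_mx; apply: posdef_diag => i; rewrite mxE. Qed.

Lemma mul_diag_conj_sum m n (H : 'M[C]_(m, n)) (d : 'rV[C]_n) :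
  H *m diag_mx d *m H^t* = \sum_k d 0 k *: (col k H *m (col k H)^t*).
Proof.
apply/matrixP=> i j; rewrite mul_mx_diag mxE summxE; apply: eq_bigr => k _.
by rewrite !mxE big_ord1 !mxE mulrA [d 0 k * _]mulrC.
Qed.

Lemma gram_sum m n (H : 'M[C]_(m, n)) :
  H^t* *m H = \sum_k 1 *: (col k (H^t*) *m (col k (H^t*))^t*).
Proof.
transitivity (H^t* *m diag_mx (const_mx 1) *m (H^t*)^t*).
  by rewrite trmxCK diag_const_mx mulmx1.
by rewrite mul_diag_conj_sum; apply: eq_bigr => k _; rewrite mxE.
Qed.

Lemma posdef_diag_gram m n (H : 'M[C]_(m, n)) (d : 'rV[C]_n) :
  (forall i, 0 < d 0 i) ->
  posdef (diag_mx d + H^t* *m H) /\ \det (diag_mx d) <= \det (diag_mx d + H^t* *m H).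
Proof.
by move=> d0; rewrite gram_sum; apply: posdef_sum_update => //; exact: posdef_diag.
Qed.

Lemma det_diag_gram_le m n (H : 'M[C]_(m, n)) (d e : 'rV[C]_n) :
  (forall i, 0 < d 0 i) -> (forall i, d 0 i <= e 0 i) ->
  \det (diag_mx d + H^t* *m H) <= \det (diag_mx e + H^t* *m H).
Proof.
move=> d0 de; have [pA _] := posdef_diag_gram H d0.
have ed0 i : 0 <= (e - d) 0 i by rewrite !mxE subr_ge0.
(* The difference [diag_mx (e - d)] is a sum of rank-one terms along the standard basis, the columns
   of [1%:M]. *)
have [_] := posdef_sum_update (index_enum _) (fun i => col i 1%:M) pA ed0.
rewrite -mul_diag_conj_sum mul1mx trmx1 map_mx1 mulmx1.
by rewrite raddfB /= addrAC addrCA subrr addr0.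
Qed.

(** By Sylvester's identity the left side is [det (I + G D)], and [I + G D = (D^-1 + G) D] because
    all powers are positive. *)
Lemma det_diag_factor m n (H : 'M[C]_(m, n)) (p : 'I_n -> C) :
  (forall k, 0 < p k) ->
  \det (1%:M + \sum_k p k *: (col k H *m (col k H)^t*)) =
  \det (diag_mx (\row_k (p k)^-1) + H^t* *m H) * \prod_k p k.
Proof.
move=> p0; pose D := diag_mx (\row_k p k).
transitivity (\det (1%:M + H *m D *m H^t*)).
  by rewrite mul_diag_conj_sum; congr (\det (_ + _)); apply: eq_bigr => k _; rewrite mxE.
rewrite det_addmulC mulmxA.
have -> : \prod_k p k = \det D by rewrite det_diag; apply: eq_bigr => k _; rewrite mxE.
rewrite -det_mulmx mulmxDl mulmx_diag.
congr (\det (_ + _)); rewrite -diag_const_mx; congr diag_mx.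
by apply/rowP => k; rewrite !mxE mulVf// gt_eqF.
Qed.

Lemma det_const_power m n (H : 'M[C]_(m, n)) (c : C) : 0 < c ->
  \det (1%:M + \sum_k c *: (col k H *m (col k H)^t*)) =
  \det (c^-1%:M + H^t* *m H) * c ^+ n.
Proof.
move=> c0; rewrite (det_diag_factor H (p := fun=> c))//; congr (_ * _).
  by rewrite -diag_const_mx; congr (\det (diag_mx _ + _)); apply/rowP => k; rewrite !mxE.
by rewrite prodr_const card_ord.
Qed.

Lemma det_power_le m n (H : 'M[C]_(m, n)) (p : 'I_n -> C) (c : C) :
  (forall k, 0 <= p k) -> 0 < c ->
  \det (1%:M + \sum_k p k *: (col k H *m (col k H)^t*)) <=
  \det (c^-1%:M + H^t* *m H) * \prod_k (p k + c).
Proof.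
move=> p0 c0; have pc0 k : 0 < p k + c by rewrite ltr_wpDl.
have le1 : \det (1%:M + \sum_k p k *: (col k H *m (col k H)^t*)) <=
    \det (1%:M + \sum_k (p k + c) *: (col k H *m (col k H)^t*)).
  (* Two successive updates of the identity: first by the powers [p k], then by the constant [c]. *)
  have [pA _] := posdef_sum_update (index_enum _) (fun k => col k H) (@posdef1 _) p0.
  have [_] := posdef_sum_update (index_enum _) (fun k => col k H) pA (fun=> ltW c0).
  rewrite -addrA -big_split /=.
  by rewrite (eq_bigr _ (fun k _ => esym (scalerDl _ (p k) c))).
apply: (le_trans le1); rewrite det_diag_factor// ler_wpM2r ?prodr_ge0//.
  by move=> k _; exact: ltW.
(* As [p k + c >= c], every inverse power is at most [c^-1], whatever the allocation. *)
rewrite -diag_const_mx; apply: det_diag_gram_le => k; rewrite !mxE ?invr_gt0//.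
by rewrite lef_pV2 ?posrE// lerDr.
Qed.

End PositiveDefinite.

(** * Properties preserved by ring operations *)

Section DeterminantFunctions.
Variables (T : Type) (C : comNzRingType) (Q : (T -> C) -> Prop).
Hypothesis Q_cst : forall c, Q (fun=> c).
Hypothesis Q_add : forall f g, Q f -> Q g -> Q (fun t => f t + g t).
Hypothesis Q_mul : forall f g, Q f -> Q g -> Q (fun t => f t * g t).

Lemma closed_sum (I : Type) (r : seq I) (f : I -> T -> C) :
  (forall i, Q (f i)) -> Q (fun t => \sum_(i <- r) f i t).
Proof.
move=> Qf; elim: r => [|i r IHr].
  by rewrite (_ : (fun _ => _) = (fun=> 0)) //; apply/funext => t; rewrite big_nil.
rewrite (_ : (fun _ => _) = (fun t => f i t + \sum_(j <- r) f j t)); first exact: Q_add.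
by apply/funext => t; rewrite big_cons.
Qed.

Lemma closed_prod (I : Type) (r : seq I) (f : I -> T -> C) :
  (forall i, Q (f i)) -> Q (fun t => \prod_(i <- r) f i t).
Proof.
move=> Qf; elim: r => [|i r IHr].
  by rewrite (_ : (fun _ => _) = (fun=> 1)) //; apply/funext => t; rewrite big_nil.
rewrite (_ : (fun _ => _) = (fun t => f i t * \prod_(j <- r) f j t)); first exact: Q_mul.
by apply/funext => t; rewrite big_cons.
Qed.

(** The Leibniz expansion is a polynomial in the entries. This serves with [Q] saying that real and
    imaginary parts are continuous, and again that they are measurable. *)
Lemma closed_det n (A : T -> 'M[C]_n) :
  (forall i j, Q (fun t => A t i j)) -> Q (fun t => \det (A t)).
Proof. by move=> QA; apply: closed_sum => s; apply: Q_mul => //; exact: closed_prod. Qed.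

End DeterminantFunctions.

Lemma ler_norm_det (R : numDomainType) n (A : 'M[R]_n) (s : R) :
  (forall i j, `|A i j| <= s) -> `|\det A| <= (n`!)%:R * s ^+ n.
Proof.
move=> As; apply: (le_trans (ler_norm_sum _ _ _)).
apply: (@le_trans _ _ (\sum_(t : 'S_n) s ^+ n)).
  apply: ler_sum => t _; rewrite normrM normrX normrN1 expr1n mul1r normr_prod.
  rewrite -[X in s ^+ X](card_ord n) -prodr_const; apply: ler_prod => i _.
  by rewrite normr_ge0 As.
by rewrite sumr_const card_Sn mulr_natl.
Qed.

(** * Real and imaginary parts *)

Section ComplexParts.
Variable R : realType.
Implicit Types x y z : R[i].

Lemma Re_add x y : Re (x + y) = Re x + Re y. Proof. by case: x y => a b [c e]. Qed.
Lemma Im_add x y : Im (x + y) = Im x + Im y. Proof. by case: x y => a b [c e]. Qed.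

Lemma Re_mul x y : Re (x * y) = Re x * Re y - Im x * Im y.
Proof. by case: x y => a b [c e]. Qed.

Lemma Im_mul x y : Im (x * y) = Re x * Im y + Im x * Re y.
Proof. by case: x y => a b [c e]; rewrite /= addrC [b * c]mulrC addrC. Qed.

Lemma Re_conjc z : Re z^*%R = Re z. Proof. by case: z. Qed.
Lemma Im_conjc z : Im z^*%R = - Im z. Proof. by case: z. Qed.

Lemma le_Re x y : x <= y -> Re x <= Re y.
Proof. by rewrite lecE => /andP[]. Qed.

Lemma Re_realM (a : R) z : Re (z * a%:C) = Re z * a.
Proof. by rewrite Re_mul mulr0 subr0. Qed.

Lemma Re_prod_real (I : finType) z (p : I -> R) :
  Re (z * \prod_i (p i)%:C) = Re z * \prod_i p i.
Proof. by rewrite -rmorph_prod Re_realM. Qed.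

Definition sqnormc z : R := Re z ^+ 2 + Im z ^+ 2.

Lemma Re_mul_conj z : Re (z * z^*%R) = sqnormc z.
Proof. by rewrite Re_mul Re_conjc Im_conjc mulrN opprK. Qed.

Lemma sqnormc_ge0 z : 0 <= sqnormc z.
Proof. by rewrite addr_ge0 ?sqr_ge0. Qed.

(** The inequality between geometric and quadratic means, with its factor one half dropped. *)
Lemma normcM_le x y : `|x * y^*%R| <= (sqnormc x + sqnormc y)%:C.
Proof.
rewrite normrM norm_conjC rmorphD /= !add_Re2_Im2.
have [m _] := real_leif_mean_square (normr_real x) (normr_real y).
apply: (le_trans m); rewrite ler_pdivrMr ?ltr0n// mulr_natr mulr2n.
by rewrite lerDl addr_ge0// exprn_ge0.
Qed.

End ComplexParts.

(** * Deterministic bounds on the rate *)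

Section LogarithmFacts.
Variable R : realType.
Implicit Types x y : R.

Lemma ln2_gt0 : 0 < ln 2 :> R.
Proof. by rewrite ln_gt0// ltr1n. Qed.

Lemma log2_le x y : 0 < x -> x <= y -> log2 x <= log2 y.
Proof.
move=> x0 xy; rewrite ler_pM2r ?invr_gt0 ?ln2_gt0// ler_ln ?posrE//.
exact: lt_le_trans xy.
Qed.

Lemma log2M x y : 0 < x -> 0 < y -> log2 (x * y) = log2 x + log2 y.
Proof. by move=> x0 y0; rewrite /log2 lnM ?posrE// mulrDl. Qed.

Lemma log2X n x : 0 < x -> log2 (x ^+ n) = n%:R * log2 x.
Proof. by move=> x0; rewrite /log2 lnXn// mulrA mulr_natl. Qed.

Lemma log2_ge0 x : 1 <= x -> 0 <= log2 x.
Proof. by move=> x1; rewrite mulr_ge0 ?ln_ge0// invr_ge0 ltW ?ln2_gt0. Qed.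

Lemma log2_le_id x : 0 < x -> log2 x <= x / ln 2.
Proof. by move=> x0; rewrite ler_pM2r ?invr_gt0 ?ln2_gt0// ltW ?ln_sublinear. Qed.

Lemma log2e_EFin x : 0 < x -> log2e x = (log2 x)%:E.
Proof. by move=> x0; rewrite /log2e lne_EFin. Qed.

Lemma log2e_Ny x : x <= 0 -> log2e x = -oo%E.
Proof.
by move=> x0; rewrite /log2e le0_lneNy ?lee_fin// mulNyr gtr0_sg ?invr_gt0 ?ln2_gt0// mul1e.
Qed.

Lemma log2e_cvg (u : R ^nat) x : (forall n, 0 < u n) -> u @ \oo --> x ->
  (log2 (u n))%:E @[n --> \oo] --> log2e x.
Proof.
move=> u0 ux; have [x0|x0] := leP x 0.
  rewrite log2e_Ny//; apply/cvgeNyPle => A.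
  (* The threshold is [2 ^ A], which is positive and therefore above the limit [x <= 0]. *)
  have : \forall n \near \oo, u n < expR (A * ln 2).
    by apply: (cvgr_lt x) => //; rewrite (le_lt_trans x0)// expR_gt0.
  apply: filterS => n un; rewrite lee_fin ler_pdivrMr ?ln2_gt0//.
  by rewrite -[leRHS]expRK ler_ln ?posrE ?expR_gt0// ltW.
rewrite log2e_EFin//; apply: cvg_EFin; first exact: nearW.
apply: cvgMl; apply: cvg_comp ux _; exact: continuous_ln.
Qed.

End LogarithmFacts.

(** * The regularized Gram determinant and the rate *)

Section RegularizedDeterminant.
Variables (R : realType) (M K : nat).
Implicit Types (h : 'I_K -> 'cV[R[i]]_M) (p : 'I_K -> R).

(** For [e > 0] this is positive and has a real logarithm; at [e = 0] it is the Gram determinant,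
    which may vanish. *)
Definition reg_det h (e : R) : R :=
  Re (\det ((e%:C)%:M + (channel_matrix h)^t* *m channel_matrix h)).

Lemma col_channel_matrix h k : col k (channel_matrix h) = h k.
Proof. by apply/colP => i; rewrite !mxE. Qed.

Lemma reg_det_ge h e : 0 < e -> e ^+ K <= reg_det h e.
Proof.
move=> e0; have [//|_] := @posdef_diag_gram _ _ _ (channel_matrix h) (const_mx e%:C).
  by move=> i; rewrite mxE ltcR.
by rewrite diag_const_mx det_scalar => /le_Re; rewrite -rmorphXn.
Qed.

Lemma reg_det_gt0 h e : 0 < e -> 0 < reg_det h e.
Proof. by move=> e0; apply: lt_le_trans (reg_det_ge h e0); rewrite exprn_gt0. Qed.

Lemma reg_det_le h e e' : 0 < e -> e <= e' -> reg_det h e <= reg_det h e'.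
Proof.
move=> e0 ee'; apply: le_Re; rewrite -!diag_const_mx.
by apply: det_diag_gram_le => i; rewrite !mxE (ltcR, lecR).
Qed.

Lemma reg_det_continuous h : continuous (reg_det h).
Proof.
pose Q (f : R -> R[i]) := continuous (fun t => Re (f t)) /\ continuous (fun t => Im (f t)).
suff [] : Q (fun e => \det ((e%:C)%:M + (channel_matrix h)^t* *m channel_matrix h)) by [].
apply: closed_det => [c|f g [f1 f2] [g1 g2]|f g [f1 f2] [g1 g2]|i j].
- by split => x; exact: cvg_cst.
- split => x.
  + under eq_fun do rewrite Re_add.
    by apply: cvgD; [exact: f1|exact: g1].
  + under eq_fun do rewrite Im_add.
    by apply: cvgD; [exact: f2|exact: g2].
- split => x.
  + under eq_fun do rewrite Re_mul.
    by apply: cvgB; apply: cvgM; [exact: f1|exact: g1|exact: f2|exact: g2].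
  + under eq_fun do rewrite Im_mul.
    by apply: cvgD; apply: cvgM; [exact: f1|exact: g2|exact: f2|exact: g1].
- split => x.
  + under eq_fun do rewrite mxE Re_add mxE raddfMn /=.
    by apply: cvgD; [apply: cvgMn; exact: cvg_id | exact: cvg_cst].
  + under eq_fun do rewrite mxE Im_add mxE raddfMn /= mul0rn.
    exact: cvg_cst.
Qed.

Lemma reg_det_cvg0 h : reg_det h n.+1%:R^-1 @[n --> \oo] --> reg_det h 0.
Proof.
apply: (@cvg_comp _ _ _ (fun n => n.+1%:R^-1) (reg_det h) _ (nbhs (0 : R))).
  exact: cvg_harmonic.
exact: reg_det_continuous.
Qed.

(** Monotonicity is available only for positive regularizations, so the value at 0 is reached as a
    limit along [1 / (n + 1)]. *)
Lemma reg_det0_le h e : 0 < e -> reg_det h 0 <= reg_det h e.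
Proof.
move=> e0; have h0 := @reg_det_cvg0 h.
rewrite -(cvg_lim (@Rhausdorff R) h0); apply: limr_le; first by apply/cvg_ex; eexists; exact: h0.
have : \forall n \near \oo, n.+1%:R^-1 < e.
  by apply: (cvgr_lt (0 : R)) => //; exact: cvg_harmonic.
by apply: filterS => n ne; rewrite reg_det_le ?invr_gt0// ltW.
Qed.

Lemma log2_det_gramE h : log2_det_gram h = log2e (reg_det h 0).
Proof. by rewrite /log2_det_gram /reg_det raddf0 add0r. Qed.

Lemma log2_det_gram_le h e : 0 < e -> (log2_det_gram h <= (log2 (reg_det h e))%:E)%E.
Proof.
move=> e0; rewrite log2_det_gramE; have [x0|x0] := leP (reg_det h 0) 0.
  by rewrite log2e_Ny ?leNye.
by rewrite log2e_EFin// lee_fin log2_le// reg_det0_le.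
Qed.

Lemma log2_reg_det_cvg h :
  (log2 (reg_det h n.+1%:R^-1))%:E @[n --> \oo] --> log2_det_gram h.
Proof.
rewrite log2_det_gramE; apply: (log2e_cvg (u := fun n => reg_det h n.+1%:R^-1)).
  by move=> n; rewrite reg_det_gt0.
exact: reg_det_cvg0.
Qed.

Lemma sum_rate_const h c : 0 < c ->
  sum_rate h (fun=> c) = log2 (reg_det h c^-1) + K%:R * log2 c.
Proof.
move=> c0; rewrite -log2X// -log2M ?exprn_gt0 ?reg_det_gt0 ?invr_gt0//.
have := det_const_power (channel_matrix h) (_ : 0 < c%:C); rewrite ltcR => /(_ c0).
rewrite (eq_bigr (fun k => c%:C *: (h k *m (h k)^t*))); last first.
  by move=> k _; rewrite col_channel_matrix.
by rewrite -fmorphV -rmorphXn => E; rewrite /sum_rate E Re_realM.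
Qed.

Lemma sum_rate_le h p pc c : 0 < c -> 0 <= pc -> (0 < K)%N ->
  power_allocations pc p ->
  sum_rate h p <= log2 (reg_det h c^-1) + K%:R * log2 ((pc + K%:R * c) / K%:R).
Proof.
move=> c0 pc0 K0 [p0 ppc].
have m0 : 0 < (pc + K%:R * c) / K%:R.
  by rewrite divr_gt0 ?ltr0n// ltr_wpDl// mulr_gt0// ltr0n.
rewrite -log2X// -log2M ?exprn_gt0 ?reg_det_gt0 ?invr_gt0//.
have p0C k : 0 <= (p k)%:C by rewrite lecR.
(* The determinant inside the rate is positive, as monotonicity of [log2] requires. *)
have [[+ _] _] := posdef_sum_update (index_enum _) h (@posdef1 _ _) p0C.
rewrite ltcE => /andP[_ s0].
apply: log2_le => //; apply: (@le_trans _ _ (reg_det h c^-1 * \prod_k (p k + c))).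
  have := det_power_le (channel_matrix h) p0C (_ : 0 < c%:C); rewrite ltcR => /(_ c0).
  rewrite (eq_bigr (fun k => (p k)%:C *: (h k *m (h k)^t*))); last first.
    by move=> k _; rewrite col_channel_matrix.
  under [X in _ <= _ * X -> _]eq_bigr do rewrite -rmorphD.
  by rewrite -fmorphV => /le_Re; rewrite Re_prod_real.
rewrite ler_wpM2l ?(ltW (reg_det_gt0 _ _)) ?invr_gt0//.
have [] := @leif_AGM R _ 'I_K (fun k => p k + c).
  by move=> k _; rewrite addr_ge0// ltW.
rewrite card_ord big_split /= sumr_const card_ord => agm _.
apply: (le_trans agm); rewrite lerXn2r ?nnegrE ?(ltW m0)//.
  by rewrite divr_ge0// addr_ge0 ?sumr_ge0// mulrn_wge0 ?ltW.
by rewrite ler_pM2r ?invr_gt0 ?ltr0n// mulr_natl lerD2r.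
Qed.

Lemma power_allocations_equal (pc : R) : 0 <= pc -> (0 < K)%N ->
  power_allocations pc (fun _ : 'I_K => pc / K%:R).
Proof.
move=> pc0 K0; split=> [k|]; first by rewrite divr_ge0.
by rewrite sumr_const card_ord -(mulr_natr (pc / _)) divfK// pnatr_eq0 -lt0n.
Qed.

Lemma downlink_rate_ge h pc : 0 < pc -> (0 < K)%N ->
  log2 (reg_det h (pc / K%:R)^-1) + K%:R * log2 (pc / K%:R) <= downlink_rate h pc.
Proof.
move=> pc0 K0; rewrite -sum_rate_const ?divr_gt0 ?ltr0n//.
apply: sup_ubound; last by exists (fun=> pc / K%:R) => //; exact: power_allocations_equal (ltW _) _.
(* The [sup] dominates members only of a set bounded above; the bound with [c = 1] supplies this. *)
exists (log2 (reg_det h 1^-1) + K%:R * log2 ((pc + K%:R * 1) / K%:R)).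
by move=> _ [p ppc <-]; apply: sum_rate_le => //; exact: ltW.
Qed.

Lemma downlink_rate_le h pc c : 0 < pc -> 0 < c -> (0 < K)%N ->
  downlink_rate h pc <=
  log2 (reg_det h c^-1) + K%:R * log2 ((pc + K%:R * c) / K%:R).
Proof.
move=> pc0 c0 K0; apply: ge_sup.
  exists (sum_rate h (fun=> pc / K%:R)), (fun=> pc / K%:R) => //.
  exact: power_allocations_equal (ltW _) _.
by move=> _ [p ppc <-]; apply: sum_rate_le => //; exact: ltW.
Qed.

(** Supplies the nonnegativity that [ge0_le_integral_nonmeasurable] asks of the smaller
    integrand. *)
Lemma sum_rate_const_ge0 h c : 0 < c -> 0 <= sum_rate h (fun=> c).
Proof.
move=> c0; apply: log2_ge0.
have c0C k : 0 <= (fun _ : 'I_K => c%:C) k by rewrite lecR ltW.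
by have [_] := posdef_sum_update (index_enum _) h (@posdef1 _ _) c0C; rewrite det1 => /le_Re.
Qed.

End RegularizedDeterminant.

(** * Expectations *)

Section Integration.
Context d (T : measurableType d) (R : realType).
Variable mu : {measure set T -> \bar R}.
Local Open Scope ereal_scope.

(* The integral of a nonnegative function is a supremum over the simple functions below
   it, so no measurability is needed; this spares a proof that [downlink_rate], a
   supremum over uncountably many allocations, is measurable. *)
Lemma ge0_le_integral_nonmeasurable (f g : T -> \bar R) :
  (forall x, 0 <= f x) -> (forall x, f x <= g x) ->
  \int[mu]_x f x <= \int[mu]_x g x.
Proof.
move=> f0 fg; have g0 x : 0 <= g x by exact: le_trans (fg x).
rewrite !ge0_integralTE//; apply: ereal_sup_le => _ [k kf <-].
by exists k => // x; exact: le_trans (fg x).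
Qed.

(** Positive and negative parts are compared separately, so the smaller integral may be [-oo], as
    can happen for [log2_det_gram]. *)
Lemma le_integral_measurable (f g : T -> \bar R) :
  measurable_fun [set: T] f -> measurable_fun [set: T] g ->
  (forall x, f x <= g x) -> \int[mu]_x f x <= \int[mu]_x g x.
Proof.
move=> mf mg fg; rewrite (integralE _ _ f) (integralE _ _ g); apply: leeB.
- apply: ge0_le_integral => //; try exact: measurable_funepos.
  by move=> x _; apply: (funepos_le (D := setT)) => //; rewrite ?inE// => y _.
- apply: ge0_le_integral => //; try exact: measurable_funeneg.
  by move=> x _; apply: (funeneg_le (D := setT)) => //; rewrite ?inE// => y _.
Qed.

Lemma cvg_maxe0 (u : (\bar R)^nat) (l : \bar R) :
  u @ \oo --> l -> maxe (u n) 0 @[n --> \oo] --> maxe l 0.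
Proof.
move=> ul; pose h := fun x y : \bar R => maxe x y.
have c0 : (fun=> 0 : \bar R) n @[n --> \oo] --> (0 : \bar R) by exact: cvg_cst.
apply: (cvg_comp2 (h := h) ul c0).
exact: (@max_continuous _ (\bar R) (l, 0)).
Qed.

(** Positive parts converge by domination by that of [f 0], negative parts by monotone convergence,
    possibly to [+oo]. *)
Lemma decreasing_convergence (f : nat -> T -> \bar R) (g : T -> \bar R) :
  (forall n, measurable_fun [set: T] (f n)) ->
  (forall x, {homo f ^~ x : m n / (m <= n)%N >-> n <= m}) ->
  (forall x, f n x @[n --> \oo] --> g x) ->
  mu.-integrable [set: T] (f 0%N) ->
  \int[mu]_x g^\+ x < +oo /\ \int[mu]_x f n x @[n --> \oo] --> \int[mu]_x g x.
Proof.
move=> mf ndf fg if0.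
have mg : measurable_fun [set: T] g.
  by apply: emeasurable_fun_cvg => [m|x _]; [exact: mf|exact: fg].
have [ig _ cpos] : [/\ mu.-integrable [set: T] g^\+,
    \int[mu]_x `|(f n)^\+ x - g^\+ x| @[n --> \oo] --> 0 &
    \int[mu]_x (f n)^\+ x @[n --> \oo] --> \int[mu]_x g^\+ x].
  apply: (@dominated_convergence _ _ _ _ _ _ (fun n => (f n)^\+) g^\+ (f 0%N)^\+) => //.
  - by move=> n; exact: measurable_funepos.
  - exact: measurable_funepos.
  - apply: aeW => x _; under eq_fun do rewrite funeposE.
    by rewrite funeposE; exact: cvg_maxe0.
  - exact: integrable_funepos.
  - apply: aeW => x n _; rewrite gee0_abs ?funepos_ge0//.
    by apply: (funepos_le (D := setT)) => //; rewrite ?inE// => y _; exact: ndf.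
have cneg : \int[mu]_x (f n)^\- x @[n --> \oo] --> \int[mu]_x g^\- x.
  have -> : g^\- = fun x => limn (fun n => (f n)^\- x).
    apply/funext => x; apply/esym/cvg_lim => //.
    under eq_fun do rewrite funenegE.
    by rewrite funenegE; apply: cvg_maxe0; apply: cvgeN; exact: fg.
  apply: cvg_monotone_convergence => //.
  - by move=> n; exact: measurable_funeneg.
  - move=> x _ m n mn.
    by apply: (funeneg_le (D := setT)) => //; rewrite ?inE// => y _; exact: ndf.
split; first exact: integrable_lty.
rewrite integralE; under eq_fun do rewrite integralE.
(* The limit is not of the form [+oo - +oo], since the positive part of [g] has a finite
   integral. *)
apply: cvgeB => //; apply: fin_num_adde_defr.
exact: integrable_fin_num.
Qed.

End Integration.

(** * Growth of the log-determinant in the channel *)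

Section ChannelBound.
Variables (R : realType) (M K : nat).
Implicit Types (h : 'I_K -> 'cV[R[i]]_M).

(** The squared Frobenius norm of the channel matrix. *)
Definition channel_power h : R := \sum_k \sum_i sqnormc (h k i 0).

Lemma channel_power_ge0 h : 0 <= channel_power h.
Proof. by do 2!(apply: sumr_ge0 => ? _); exact: sqnormc_ge0. Qed.

(** Each entry of [I + G] has modulus at most [1 + 2 * channel_power h], and the Leibniz expansion
    has [K!] terms. *)
Lemma reg_det1_le h :
  reg_det h 1 <= (K`!)%:R * (1 + (channel_power h *+ 2)) ^+ K.
Proof.
set s := 1 + _; have s0 : 0 <= s by rewrite addr_ge0// mulrn_wge0// channel_power_ge0.
have colpow k : \sum_i sqnormc (h k i 0) <= channel_power h.
  rewrite /channel_power (bigD1 k)//= lerDl.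
  by do 2!(apply: sumr_ge0 => ? _); exact: sqnormc_ge0.
suff D : `|\det (1%:C%:M + (channel_matrix h)^t* *m channel_matrix h)| <= (K`!)%:R * s%:C ^+ K.
  have := le_trans (normc_ge_Re _) D.
  rewrite -rmorphXn -(rmorph_nat (real_complex R)) -rmorphM lecR.
  exact: le_trans (ler_norm _).
apply: ler_norm_det => i j; rewrite mxE; apply: (le_trans (ler_normD _ _)).
rewrite rmorphD /= lerD//.
  by rewrite mxE; case: (i == j); rewrite ?mulr1n ?normr1// mulr0n normr0 ler01.
rewrite mxE; apply: (le_trans (ler_norm_sum _ _ _)).
apply: (@le_trans _ _ (\sum_m (sqnormc (h j m 0) + sqnormc (h i m 0))%:C)).
  by apply: ler_sum => m _; rewrite !mxE mulrC; exact: normcM_le.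
by rewrite -rmorph_sum lecR big_split /= mulr2n lerD.
Qed.

(** The logarithm makes the polynomial bound linear in the channel power, so second moments control
    its expectation. *)
Lemma log2_reg_det1_le h :
  log2 (reg_det h 1) <=
  log2 (K`!)%:R + K%:R * ((ln 2)^-1 + (2 / ln 2) * channel_power h).
Proof.
have s0 : 0 < 1 + channel_power h *+ 2.
  by rewrite ltr_pwDl// mulrn_wge0// channel_power_ge0.
apply: (le_trans (log2_le (reg_det_gt0 _ ltr01) (reg_det1_le h))).
rewrite log2M ?ltr0n ?fact_gt0 ?exprn_gt0// log2X// lerD2l ler_wpM2l//.
apply: (le_trans (log2_le_id s0)).
by rewrite mulrDl mul1r -(mulr_natl (channel_power h)) mulrAC.
Qed.

End ChannelBound.

(** * Expected log-determinants and the ergodic rate *)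

Section RandomChannel.
Variables (R : realType) (d : measure_display) (T : measurableType d).
Variable P : probability T R.
Variables (M K : nat) (h : 'I_K -> T -> 'cV[R[i]]_M).
Hypothesis mh : forall k, random_vector (h k).

Lemma measurable_entry k i :
  measurable_fun [set: T] (fun w => Re (h k w i 0)) /\
  measurable_fun [set: T] (fun w => Im (h k w i 0)).
Proof.
have mi := (measurable_fun_tnthP _).1 (mh k) i.
split.
- rewrite (_ : (fun _ => _) = fst \o ((@tnth _ _)^~ i \o (fun w => cV_coords (h k w)))).
    exact: measurableT_comp measurable_fst mi.
  by apply/funext => w /=; rewrite tnth_mktuple.
- rewrite (_ : (fun _ => _) = snd \o ((@tnth _ _)^~ i \o (fun w => cV_coords (h k w)))).
    exact: measurableT_comp measurable_snd mi.
  by apply/funext => w /=; rewrite tnth_mktuple.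
Qed.

Lemma measurable_reg_det e : measurable_fun [set: T] (fun w => reg_det (h^~ w) e).
Proof.
pose Q (f : T -> R[i]) := measurable_fun [set: T] (fun t => Re (f t)) /\
                          measurable_fun [set: T] (fun t => Im (f t)).
have Qc c : Q (fun=> c) by split; exact: measurable_cst.
have QD f g : Q f -> Q g -> Q (fun t => f t + g t).
  move=> [f1 f2] [g1 g2]; split.
  - by under eq_fun do rewrite Re_add; exact: measurable_funD.
  - by under eq_fun do rewrite Im_add; exact: measurable_funD.
have QM f g : Q f -> Q g -> Q (fun t => f t * g t).
  move=> [f1 f2] [g1 g2]; split.
  - under eq_fun do rewrite Re_mul.
    by apply: measurable_funB; exact: measurable_funM.
  - under eq_fun do rewrite Im_mul.
    by apply: measurable_funD; exact: measurable_funM.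
suff [] : Q (fun w => \det (e%:C%:M + (channel_matrix (h^~ w))^t* *m channel_matrix (h^~ w))) by [].
apply: closed_det => // i j; under eq_fun do rewrite mxE; apply: (QD _ _); first exact: Qc.
under eq_fun do rewrite mxE; apply: (closed_sum Qc QD) => m; apply: QM.
- under eq_fun do rewrite !mxE; have [m1 m2] := measurable_entry i m; split.
  + by under eq_fun do rewrite Re_conjc.
  + by under eq_fun do rewrite Im_conjc; exact: measurable_funN.
- by under eq_fun do rewrite !mxE; exact: measurable_entry.
Qed.

Lemma measurable_log2_reg_det e :
  measurable_fun [set: T] (fun w => log2 (reg_det (h^~ w) e)).
Proof.
apply: measurable_funM; last exact: measurable_cst.
exact: measurableT_comp (@measurable_ln R) (measurable_reg_det e).
Qed.

Hypothesis moment2 : forall k i, (\int[P]_w (sqnormc (h k w i 0))%:E < +oo)%E.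

Lemma integrable_channel_power :
  P.-integrable [set: T] (fun w => (channel_power (h^~ w))%:E).
Proof.
under eq_fun do rewrite /channel_power -sumEFin.
apply: integrable_sum => // k _; under eq_fun do rewrite -sumEFin.
apply: integrable_sum => // i _; apply/integrableP; split.
  apply/measurable_EFinP; have [m1 m2] := measurable_entry k i.
  by apply: measurable_funD; exact: measurable_funX.
by under eq_integral do rewrite gee0_abs ?lee_fin ?sqnormc_ge0//; exact: moment2.
Qed.

(** The dominating [B] adds the absolute value of the lower bound [K log2 e] to an upper bound for
    the value at [e = 1]. *)
Lemma integrable_log2_reg_det e : 0 < e -> e <= 1 ->
  P.-integrable [set: T] (fun w => (log2 (reg_det (h^~ w) e))%:E).
Proof.
move=> e0 e1.
pose B w := `|K%:R * log2 e| +
  (`|log2 (K`!)%:R| + K%:R * ((ln 2)^-1 + (2 / ln 2) * channel_power (h^~ w))).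
apply: (@le_integrable _ _ _ _ _ measurableT _ (fun w => (B w)%:E)).
- by apply/measurable_EFinP; exact: measurable_log2_reg_det.
- move=> w _; rewrite lee_fin.
  have B0 : 0 <= K%:R * ((ln 2)^-1 + (2 / ln 2) * channel_power (h^~ w)).
    have l0 := ltW (ln2_gt0 R).
    by rewrite mulr_ge0// addr_ge0 ?invr_ge0// mulr_ge0 ?channel_power_ge0// divr_ge0.
  have B1 : 0 <= B w by rewrite !addr_ge0.
  rewrite (ger0_norm B1) ler_norml; apply/andP; split.
    apply: (@le_trans _ _ (K%:R * log2 e)).
      by rewrite lerNl /B (le_trans (ler_norm _))// normrN lerDl addr_ge0.
    by rewrite -log2X// log2_le ?exprn_gt0// reg_det_ge.
  apply: (le_trans (log2_le (reg_det_gt0 _ e0) (reg_det_le _ e0 e1))).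
  apply: (le_trans (log2_reg_det1_le _)); rewrite /B.
  by apply: ler_wpDl => //; rewrite lerD2r ler_norm.
- under eq_fun do rewrite /B EFinD EFinD EFinM EFinD EFinM.
  apply: integrableD => //; first exact: finite_measure_integrable_cst.
  apply: integrableD => //; first exact: finite_measure_integrable_cst.
  apply: integrableZl => //; apply: integrableD => //; first exact: finite_measure_integrable_cst.
  by apply: integrableZl => //; exact: integrable_channel_power.
Qed.

Lemma integral_log2_reg_det_cvg :
  (\int[P]_w ((fun w => log2_det_gram (h^~ w))^\+ w) < +oo /\
   \int[P]_w (log2 (reg_det (h^~ w) n.+1%:R^-1))%:E @[n --> \oo] -->
   \int[P]_w log2_det_gram (h^~ w))%E.
Proof.
apply: (decreasing_convergence (f := fun n w => (log2 (reg_det (h^~ w) n.+1%:R^-1))%:E)).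
- by move=> n; apply/measurable_EFinP; exact: measurable_log2_reg_det.
- move=> w m n mn; rewrite lee_fin log2_le ?reg_det_gt0 ?invr_gt0//.
  by rewrite reg_det_le ?invr_gt0// lef_pV2 ?posrE ?ltr0n// ler_nat ltnS.
- by move=> w; exact: log2_reg_det_cvg.
(* The sequence starts at [e = 1], within the range of integrability. *)
- by apply: integrable_log2_reg_det; rewrite ?invr1.
Qed.

Lemma integral_shift e a : 0 < e -> e <= 1 ->
  (\int[P]_w (log2 (reg_det (h^~ w) e) + a)%:E =
   \int[P]_w (log2 (reg_det (h^~ w) e))%:E + a%:E)%E.
Proof.
move=> e0 e1; rewrite integralD_EFin//.
- by rewrite (integral_cst P measurableT a%:E)/= probability_setT mule1.
- exact: integrable_log2_reg_det.
- exact: finite_measure_integrable_cst.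
Qed.

Lemma ergodic_downlink_rate_ge (pc : R) : (0 < K)%N -> K%:R <= pc ->
  (\int[P]_w log2_det_gram (h^~ w) <=
   ergodic_downlink_rate P h pc - (K%:R * log2 (pc / K%:R))%:E)%E.
Proof.
move=> K0 Kpc; have K0R : 0 < K%:R :> R by rewrite ltr0n.
have pc0 : 0 < pc by exact: lt_le_trans Kpc.
set e := (pc / K%:R)^-1.
have e0 : 0 < e by rewrite invr_gt0 divr_gt0.
(* The assumption [K <= pc] keeps [e = K / pc] in the range where integrability is known. *)
have e1 : e <= 1 by rewrite invf_le1 ?divr_gt0// ler_pdivlMr// mul1r.
rewrite leeBrDr// /ergodic_downlink_rate unlock.
apply: (@le_trans _ _ (\int[P]_w (log2 (reg_det (h^~ w) e) + K%:R * log2 (pc / K%:R))%:E)%E).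
  rewrite integral_shift// leeD2r//; apply: le_integral_measurable.
  - apply: emeasurable_fun_cvg; last by move=> w _; exact: log2_reg_det_cvg.
    by move=> n; apply/measurable_EFinP; exact: measurable_log2_reg_det.
  - by apply/measurable_EFinP; exact: measurable_log2_reg_det.
  - by move=> w; exact: log2_det_gram_le.
apply: ge0_le_integral_nonmeasurable => w; rewrite lee_fin.
  (* The integrand is the sum rate of the equal allocation, hence nonnegative. *)
  by rewrite -sum_rate_const ?divr_gt0// sum_rate_const_ge0 ?divr_gt0.
exact: downlink_rate_ge.
Qed.

Lemma ergodic_downlink_rate_le (pc c : R) : (0 < K)%N -> 0 < pc -> 1 <= c ->
  (ergodic_downlink_rate P h pc - (K%:R * log2 (pc / K%:R))%:E <=
   \int[P]_w (log2 (reg_det (h^~ w) c^-1))%:E +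
   (K%:R * (K%:R * c / pc / ln 2))%:E)%E.
Proof.
move=> K0 pc0 c1; have K0R : 0 < K%:R :> R by rewrite ltr0n.
have c0 : 0 < c by exact: lt_le_trans c1.
have ci : c^-1 <= 1 by rewrite invf_le1.
rewrite leeBlDr// -addeA -EFinD -integral_shift ?invr_gt0//.
rewrite /ergodic_downlink_rate unlock.
apply: ge0_le_integral_nonmeasurable => w; rewrite lee_fin.
  apply: le_trans (downlink_rate_ge _ pc0 K0).
  by rewrite -sum_rate_const ?divr_gt0// sum_rate_const_ge0 ?divr_gt0.
apply: (le_trans (downlink_rate_le _ pc0 c0 K0)).
rewrite lerD2l -mulrDr ler_wpM2l//.
have r0 : 0 < K%:R * c / pc by rewrite divr_gt0// mulr_gt0.
(* Splitting off [pc / K] leaves [log2 (1 + K c / pc)], bounded through [ln (1 + x) <= x]. *)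
have -> : (pc + K%:R * c) / K%:R = (1 + K%:R * c / pc) * (pc / K%:R).
  by rewrite mulrA [in RHS]mulrDl mul1r divfK// gt_eqF.
rewrite log2M ?divr_gt0 ?addr_gt0// lerD2r.
rewrite ler_pM2r ?invr_gt0 ?ln2_gt0// le_ln1Dx//.
by rewrite (lt_trans _ r0)// oppr_lt0.
Qed.

End RandomChannel.

(** * A regularization scale tending to infinity more slowly than the power *)

Section TruncatedSquareRoot.
Variable R : realType.
Implicit Types pc : R.

(** An integer scale lets a limit along the naturals be transported to [pc] tending to infinity. *)
Lemma trunc_sqrt_cvg : Num.trunc (Num.sqrt pc) @[pc --> +oo_R] --> \oo.
Proof.
move=> A [N _ NA].
have : \forall pc \near +oo_R, N%:R ^+ 2 <= pc.
  by apply: nbhs_pinfty_ge; exact: num_real.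
apply: filterS => pc Npc; apply: NA => /=.
rewrite truncn_ge_nat ?sqrtr_ge0// -(ger0_norm (ler0n R N)) -sqrtr_sqr.
by rewrite ler_sqrt// (le_trans _ Npc)// sqr_ge0.
Qed.

Lemma trunc_sqrt_div_cvg0 :
  (Num.trunc (Num.sqrt pc)).+1%:R / pc @[pc --> +oo_R] --> 0.
Proof.
apply/cvgr0Pnorm_lt => e e0.
(* For [pc >= 1] the numerator is at most [2 sqrt pc], so the quotient is at most [2 / sqrt pc],
   which is below [e] once [pc > (2 / e)^2]. *)
have : \forall pc \near +oo_R, 1 <= pc /\ (2 / e) ^+ 2 < pc.
  by near=> pc; split; near: pc; [apply: nbhs_pinfty_ge|apply: nbhs_pinfty_gt]; exact: num_real.
apply: filterS => pc [pc1 epc]; have pc0 : 0 < pc by exact: lt_le_trans pc1.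
have s0 : 0 < Num.sqrt pc by rewrite sqrtr_gt0.
have s1 : 1 <= Num.sqrt pc by rewrite -sqrtr1 ler_sqrt ?(ltW pc0).
have es : 2 / e < Num.sqrt pc.
  by rewrite -(ltr_pXn2r (n := 2)) ?nnegrE ?sqrtr_ge0 ?divr_ge0 ?ltW// sqr_sqrtr ?ltW.
rewrite ger0_norm ?divr_ge0 ?ltW//.
have ts : (Num.trunc (Num.sqrt pc)).+1%:R <= Num.sqrt pc + Num.sqrt pc.
  by rewrite -natr1 lerD// truncn_le ltW.
rewrite -[X in _ / X](sqr_sqrtr (ltW pc0)) expr2 invfM mulrA.
rewrite ltr_pdivrMr// mulrC; apply: (@le_lt_trans _ _ 2).
  by rewrite ler_pdivrMl// mulr_natr mulr2n.
by rewrite mulrC -ltr_pdivrMr.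
Unshelve. all: by end_near. Qed.

End TruncatedSquareRoot.

(** The second moment of an entry is a diagonal entry of the covariance matrix, hence a finite
    number. *)
Lemma CN0_moment2 (R : realType) (d : measure_display) (T : measurableType d)
    (P : probability T R) (n : nat) (A : 'M[R[i]]_n) (X : T -> 'cV[R[i]]_n) i :
  CN0 P A X -> (\int[P]_w (sqnormc (X w i 0))%:E < +oo)%E.
Proof.
move=> [_ _ _ _ /(_ i i)[E _]]; move: E; rewrite unlock.
under eq_integral do rewrite mxE big_ord1 !mxE Re_mul_conj.
by move=> ->; rewrite ltry.
Qed.

(** The first conjunct ensures that the limiting expectation is well defined in [[-oo, +oo)]. *)
Theorem theorem2 (R : realType) (d : measure_display) (T : measurableType d)
    (P : probability T R) (M K : nat) (hK : (1 <= K)%N) (hKM : (K <= M)%N)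
    (Rcor : 'I_K -> 'M[R[i]]_M) (hRcor : forall k, hermitian_psd (Rcor k))
    (h : 'I_K -> T -> 'cV[R[i]]_M)
    (hindep : mutually_independent P h)
    (hCN : forall k, CN0 P (Rcor k) (h k)) :
  (\int[P]_w ((fun w' => log2_det_gram (fun k => h k w')) ^\+ w) < +oo)%E /\
  (ergodic_downlink_rate P h pc - (K%:R * log2 (pc / K%:R))%:E)%E
    @[pc --> +oo%R] -->
  (\int[P]_w log2_det_gram (fun k => h k w))%E.
Proof.
have mh k : random_vector (h k) by case: (hCN k).
have m2 k i : (\int[P]_w (sqnormc (h k w i 0))%:E < +oo)%E by exact: CN0_moment2 (hCN k).
have [pos lim] := integral_log2_reg_det_cvg mh m2; split=> //.
pose N (pc : R) := Num.trunc (Num.sqrt pc).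
(* The upper bound is taken with [c = N pc + 1], so that [c >= 1] and [c^-1] runs through the
   sequence [1 / (n + 1)]. *)
pose upper pc := (\int[P]_w (log2 (reg_det (h^~ w) (N pc).+1%:R^-1))%:E +
  (K%:R * (K%:R * (N pc).+1%:R / pc / ln 2))%:E)%E.
apply: (squeeze_cvge (f := fun=> (\int[P]_w log2_det_gram (h^~ w))%E) (h := upper)).
- near=> pc.
  have Kpc : K%:R <= pc by near: pc; apply: nbhs_pinfty_ge; exact: num_real.
  have pc0 : 0 < pc by apply: lt_le_trans Kpc; rewrite ltr0n.
  apply/andP; split; first exact: ergodic_downlink_rate_ge.
  by apply: ergodic_downlink_rate_le => //; rewrite ler1n.
- exact: cvg_cst.
(* The sum of limits is defined even if the first is [-oo], because the second is 0. *)
- rewrite -[X in _ --> X]adde0; apply: cvgeD; first exact: fin_num_adde_defl.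
    exact: (cvg_comp N _ (@trunc_sqrt_cvg R) lim).
  apply: cvg_EFin; first exact: nearW.
  have E pc : K%:R * (K%:R * (N pc).+1%:R / pc / ln 2) =
      K%:R * K%:R / ln 2 * ((N pc).+1%:R / pc).
    by rewrite -!mulrA; congr (_ * (_ * _)); rewrite mulrA mulrC.
  under eq_fun do rewrite E.
  rewrite -(mulr0 (K%:R * K%:R / ln 2)); apply: cvgMr; exact: trunc_sqrt_div_cvg0.
Unshelve. all: by end_near. Qed.
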